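(* Let $(M,d)$ be a metric space, $X$ a Banach space and $\alpha\geq 0$. Let $\varphi:M\to 2^{X}$ be a closed- and convex-valued lower hemicontinuous correspondence that is lower pointwise $(\alpha+\varepsilon)$-Lipschitz for every $\varepsilon>0$. Then, for any $\beta>\alpha$, there exists a continuous selection of $\varphi$ that is pointwise $\beta$-Lipschitz on a dense set of $M$. If, additionally, there exists a bounded continuous selection of $\varphi$, then, for any $\beta>\alpha$, there also exists a bounded continuous selection of $\varphi$ that is pointwise $\beta$-Lipschitz on a dense set of $M$.
   Context: A correspondence from a set $A$ to a set $B$ is a set-valued map $\varphi:A\to 2^{B}$. It is closed-valued (respectively convex-valued) if $\varphi(a)$ is closed (respectively convex) for all $a\in A$. A selection of $\varphi$ is a function $f:A\to B$ with $f(a)\in\varphi(a)$ for all $a\in A$. If $A,B$ are topological spaces, $\varphi$ is lower hemicontinuous if, for every $a\in A$ and every open $U\subseteq B$ with $\varphi(a)\cap U\neq\emptyset$, there is an open set $V\ni a$ such that $\varphi(v)\cap U\ne\emptyset$ for all $v\in V$. For a metric space $(M,d)$, a normed space $X$ with closed unit ball $\mathbf{B}_X$, and $\gamma\ge 0$, a correspondence $\varphi:M\to 2^X$ is lower pointwise $\gamma$-Lipschitz at $b\in M$ if, for every $y\in\varphi(b)$ and every $a\in M$, the set $\varphi(a)\cap\left(y+\gamma\, d(b,a)\,\mathbf{B}_X\right)$ is non-empty. It is lower pointwise $\gamma$-Lipschitz if this holds at every $b\in M$. A map $f:M\to X$ is pointwise $\beta$-Lipschitz at $b\in M$ if $\limsup_{r\to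 0^+}\left(r^{-1}\sup\{\|f(b)-f(a)\| : a\in M,\ d(a,b)\le r\}\right)\le\beta$. It is pointwise $\beta$-Lipschitz on a set $S\subseteq M$ if this holds at every point of $S$.
   Formalization: The correspondence is assumed to have non-empty values; without this the constant empty correspondence on a non-empty M satisfies every hypothesis vacuously and has no selection. *)

(* Defs.v *)
From mathcomp Require Import all_boot all_order all_algebra.
From mathcomp Require Import all_classical all_reals all_analysis.

Set Implicit Arguments.
Unset Strict Implicit.
Unset Printing Implicit Defensive.

Import Order.TTheory GRing.Theory Num.Theory.
Import numFieldNormedType.Exports.

Local Open Scope classical_set_scope.
Local Open Scope ring_scope.

(* A correspondence from A to B is a term of type A -> set B. Empty values are
   not excluded by the type; nonempty_valued excludes them, as the constant
   empty correspondence satisfies vacuously the conditions below but has no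
   selection. *)

Definition is_selection (A B : Type) (phi : A -> set B) (f : A -> B) : Prop :=
  forall a, phi a (f a).

Definition nonempty_valued (A B : Type) (phi : A -> set B) : Prop :=
  forall a, phi a !=set0.

Definition closed_valued (A : Type) (B : topologicalType)
    (phi : A -> set B) : Prop :=
  forall a, closed (phi a).

Definition convex_valued (R : realType) (A : Type) (X : normedModType R)
    (phi : A -> set X) : Prop :=
  forall a, convex_set (phi a).

Definition lower_hemicontinuous (A B : topologicalType)
    (phi : A -> set B) : Prop :=
  forall (a : A) (U : set B), open U -> phi a `&` U !=set0 ->
    exists V : set A, [/\ open V, V a & forall v, V v -> phi v `&` U !=set0].

Definition closed_unit_ball (R : realType) (X : normedModType R) : set X :=
  [set u | `|u| <= 1].

Definition lower_pointwise_lipschitz_at (R : realType) (M : metricType R)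
    (X : normedModType R) (gamma : R) (phi : M -> set X) (b : M) : Prop :=
  forall y : X, phi b y -> forall a : M,
    phi a `&` [set y + (gamma * mdist b a) *: u | u in @closed_unit_ball R X]
      !=set0.

Definition lower_pointwise_lipschitz (R : realType) (M : metricType R)
    (X : normedModType R) (gamma : R) (phi : M -> set X) : Prop :=
  forall b : M, lower_pointwise_lipschitz_at gamma phi b.

(* The supremum is taken in the extended reals: it is +oo when f is unbounded
   on the closed ball of radius r around b. *)
Definition pointwise_lipschitz_at (R : realType) (M : metricType R)
    (X : normedModType R) (beta : R) (f : M -> X) (b : M) : Prop :=
  (limf_esup (fun r : R => (r^-1)%:E *
     ereal_sup [set `|f b - f a|%:E | a in [set a | (mdist a b <= r)%R]])
     (0 : R)^'+ <= beta%:E)%E.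

Definition pointwise_lipschitz_on (R : realType) (M : metricType R)
    (X : normedModType R) (beta : R) (f : M -> X) (S : set M) : Prop :=
  forall b : M, S b -> pointwise_lipschitz_at beta f b.

(* Main.v *)
(* Michael's theorem, applied to the correspondence that takes the value {c} at
   b and phi(x) intersected with the open ball of radius beta d(b, x) around c
   at x <> b, gives a continuous selection g of phi with
   |g(x) - c| <= beta d(b, x) for all x. Hence a continuous selection f can be
   modified near the points b of a separated set, by convex interpolation
   between f and such a g with c = f(b), and thus made pointwise
   beta-Lipschitz at these points.
   Do this successively for maximal 2^-n-separated sets D_n, keeping the n-th
   modification at x below eps 2^-n min(1, d(x, A)), where A is the closed set
   of the points already treated: the modifications converge uniformly, and
   those following the treatment of b add at most 2 eps to the Lipschitz
   constant at b. *)
Require Import Defs.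
From mathcomp Require Import all_boot all_order all_algebra.
From mathcomp Require Import all_classical all_reals all_analysis.
From mathcomp Require Import finmap lra.
From mathcomp Require wochoice.
Import Order.TTheory GRing.Theory Num.Theory.
Import numFieldNormedType.Exports.
Local Open Scope classical_set_scope.
Local Open Scope ring_scope.

Set Implicit Arguments.
Unset Strict Implicit.

(** * Suprema of bounded families of real functions *)

Section suprema.
Context {R : realType} {I : Type}.

Lemma le_sup_range (h : I -> R) (c : R) (i : I) :
  (forall j, h j <= c) -> h i <= sup (range h).
Proof.
move=> hc; apply: ub_le_sup; last by exists i.
by exists c => _ [j _ <-].
Qed.

Lemma sup_range_le (h : I -> R) (c : R) (i : I) :
  (forall j, h j <= c) -> sup (range h) <= c.
Proof.
by move=> hc; apply: ge_sup => [|_ [j _ <-]//]; exists (h i), i.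
Qed.

Lemma sup_range_lipschitz (M : Type) (d : M -> M -> R) (k c : R)
    (h : I -> M -> R) (i : I) : (forall j x, h j x <= c) ->
  (forall j x y, h j x - h j y <= k * d x y) ->
  forall x y, sup (range (h ^~ x)) - sup (range (h ^~ y)) <= k * d x y.
Proof.
move=> hc hk x y; rewrite lerBlDr; apply: sup_range_le => // j.
by rewrite -lerBlDr (le_trans _ (hk j x y))// lerB// (@le_sup_range (h ^~ y) c).
Qed.

(* The map [i |-> Num.trunc (u i / c)] is injective on [A] and takes finitely
   many values. *)
Lemma finite_separated (u : I -> R) (c : R) (A : set I) : 0 < c ->
  (forall i, 0 <= u i <= 1) ->
  (forall i j, A i -> A j -> i <> j -> c <= `|u i - u j|) -> finite_set A.
Proof.
move=> c0 u01 uA; pose f i := Num.trunc (u i / c).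
have fle i : (f i)%:R <= u i / c < (f i).+1%:R.
  by apply: truncn_itv; rewrite divr_ge0 ?(ltW c0)//; case/andP: (u01 i).
have finj : {in A &, injective f}.
  move=> i j /set_mem Ai /set_mem Aj fij; apply: contrapT => ij.
  have := uA _ _ Ai Aj ij; rewrite leNgt => /negP; apply.
  have := fle i; have := fle j; rewrite fij -!natr1 !ler_pdivlMr// !ltr_pdivrMr//.
  by move=> /andP[? ?] /andP[? ?]; rewrite ltr_norml; apply/andP; split; lra.
have : finite_set (f @` A).
  apply: (@sub_finite_set _ _ `I_(Num.trunc c^-1).+1); last exact: finite_II.
  move=> _ [i Ai <-] /=; rewrite ltnS; apply: le_truncn.
  by rewrite ler_pdivrMr// mulVf ?gt_eqF//; case/andP: (u01 i).
by rewrite (eq_finite_set (inj_card_eq finj)).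
Qed.

End suprema.

(** * Locally finite families of Lipschitz functions *)

Section partition.
Context {R : realType} {M : metricType R} {I : eqType}.

(* Well-order the indices and keep from [u i] the amount [v i] by which it
   exceeds all its predecessors: at each point only finitely many [v i] exceed
   a given positive constant, and [v i = u i] for the first [i] with
   [0 < u i]. Truncating at half of the supremum [m] of the [v i] makes the
   family locally finite. *)
Lemma locally_finite_refinement (u : I -> M -> R) :
  (forall i x, 0 <= u i x <= 1) ->
  (forall i x y, u i x - u i y <= mdist x y) ->
  (forall x, exists i, 0 < u i x) ->
  exists w : I -> M -> R,
    [/\ forall i x, 0 <= w i x,
        forall i x y, w i x - w i y <= 3 * mdist x y,
        forall i x, 0 < w i x -> 0 < u i x,
        forall x, exists i, 0 < w i x &
        forall x : M, exists2 F : set I, finite_set F &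
          \forall y \near x, forall i, 0 < w i y -> F i].
Proof.
move=> u01 ulip upos.
have u0 i x : 0 <= u i x by case/andP: (u01 i x).
have u1 i x : u i x <= 1 by case/andP: (u01 i x).
have d0 (x y : M) : 0 <= mdist x y by exact: mdist_ge0.
have [le wo] := wochoice.well_ordering_principle I.
have woT : wochoice.wo_chain le predT by move=> A _; exact: wo.
have tot i j : le i j || le j i by exact: (wochoice.wo_chainW woT).
have anti i j : le i j -> le j i -> i = j.
  move=> ij ji; apply: (wochoice.wo_chain_antisymmetric woT) => //.
  by rewrite ij.
(* [H i j] vanishes unless [j] strictly precedes [i], so [s i] below is the supremum of the [u j]
   over the predecessors of [i], and 0 for the first index. *)
pose H i j x := if le j i && (j != i) then u j x else 0.
have H0 i j x : 0 <= H i j x by rewrite /H; case: ifP.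
have H1 i j x : H i j x <= 1 by rewrite /H; case: ifP.
have Hlip i j x y : H i j x - H i j y <= 1 * mdist x y.
  by rewrite mul1r /H; case: ifP => // _; rewrite subrr.
pose s i x := sup (range (H i ^~ x)).
have s0 i x : 0 <= s i x.
  rewrite (le_trans (H0 i i x)) //.
  exact: (@le_sup_range _ _ (H i ^~ x) 1).
have slip i x y : s i x - s i y <= mdist x y.
  by rewrite -[leRHS]mul1r; exact: (sup_range_lipschitz i (H1 i) (Hlip i)).
have us i j x : le j i -> j <> i -> u j x <= s i x.
  move=> ji /eqP nji; have := @le_sup_range _ _ (H i ^~ x) 1 j (fun k => H1 i k x).
  by rewrite /H ji nji.
pose v i x := Num.max 0 (u i x - s i x).
have v1 i x : v i x <= 1.
  by rewrite ge_max ler01/=; have := u1 i x; have := s0 i x; lra.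
have vlip i x y : v i x - v i y <= 2 * mdist x y.
  have := ulip i x y; have := slip i y x; rewrite metric_sym.
  have := d0 x y; rewrite /v !maxEle; do 2 case: ifPn; rewrite -?ltNge; lra.
pose m x := sup (range (v ^~ x)).
have mlip x y : m x - m y <= 2 * mdist x y.
  by have [i _] := upos x; exact: (sup_range_lipschitz i v1 vlip).
have vm i x : v i x <= m x by exact: (@le_sup_range _ _ (v ^~ x) 1).
have m0 x : 0 < m x.
  (* The first [i] with [0 < u i x] has [s i x = 0], hence [v i x = u i x > 0]. *)
  have /wo [i [[ui imin] _]] : wochoice.nonempty (fun i => 0 < u i x).
    exact: upos.
  rewrite (lt_le_trans _ (vm i x))// lt_max; apply/orP; right.
  rewrite subr_gt0 (@le_lt_trans _ _ 0)//; apply: (sup_range_le i) => j.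
  rewrite /H; case: ifP => // /andP[ji nji]; rewrite leNgt; apply/negP => uj.
  by rewrite (anti j i ji (imin j uj)) eqxx in nji.
have vfin x c : 0 < c -> finite_set [set i | c < v i x].
  move=> c0; apply: (@finite_separated _ _ (u ^~ x) c) => //.
  (* If [j] comes after [i], then [c < v j x] says that [u j x] exceeds [u i x] by more than [c]. *)
  suff sep i j : c < v i x -> c < v j x -> le i j -> i <> j ->
      c <= `|u i x - u j x|.
    move=> i j /= vi vj ij; have /orP[lij|lji] := tot i j; first exact: sep.
    by rewrite distrC; apply: sep => // /esym.
  move=> _ vj lij ij; rewrite distrC (le_trans _ (ler_norm _)) //.
  move: vj; rewrite lt_max ltNge (ltW c0)/= => vj.
  have := us _ _ x lij ij; lra.
pose w i x := Num.max 0 (v i x - m x / 2).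
have wvm i x : 0 < w i x -> m x / 2 < v i x.
  by rewrite lt_max ltxx/= subr_gt0.
exists w; split.
- by move=> i x; rewrite le_max lexx.
- move=> i x y; have := vlip i x y; have := mlip y x; rewrite metric_sym.
  have := d0 x y; rewrite /w !maxEle; do 2 case: ifPn; rewrite -?ltNge; lra.
- move=> i x /wvm; have := m0 x; have := s0 i x.
  by rewrite /v lt_max => ? ? /orP[|]; lra.
- move=> x; have [y [i _ <-] vi] : exists2 y, range (v ^~ x) y & m x / 2 < y.
    apply: sup_gt; last by rewrite -/(m x); have := m0 x; lra.
    by have [i _] := upos x; exists (v i x), i.
  by exists i; rewrite lt_max subr_gt0 vi orbT.
(* Let [0 < w i y], so [m y / 2 < v i y]. As [v i] and [m] change by at most [2 d(x, y)], [v i x]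
   exceeds [m x / 2 - 3 d(x, y)], which is above [m x / 4] when [d(x, y) < m x / 16]. *)
- move=> x; exists [set i | m x / 4 < v i x].
    by apply: vfin; rewrite divr_gt0.
  apply/metricType_numDomainType.nbhs_mdistP; exists (m x / 16) => /=.
    by rewrite divr_gt0.
  move=> y /= xy i /wvm; have := vlip i y x; have := mlip x y.
  rewrite (metric_sym y x); have := m0 x; lra.
Qed.

End partition.

Lemma lipschitz_continuous {R : realType} {M : metricType R} (k : R)
    (f : M -> R) : (forall x y, f x - f y <= k * mdist x y) -> continuous f.
Proof.
move=> flip x; apply/cvgrPdist_lt => e e0.
apply/metricType_numDomainType.nbhs_mdistP.
(* The denominator stays positive for every sign of [k]. *)
exists (e / (`|k| + 1)) => /=; first by rewrite divr_gt0// ltr_wpDl.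
move=> y /=; rewrite ltr_pdivlMr ?ltr_wpDl// => xy.
have := flip x y; have := flip y x; rewrite (metric_sym y x) ltr_norml.
have : k * mdist x y < e.
  rewrite (le_lt_trans _ xy)// mulrC ler_wpM2l ?mdist_ge0//.
  by have := ler_norm k; lra.
by move=> ? ? ?; apply/andP; split; lra.
Qed.

(** * Convexity, lower hemicontinuity and approximate selections *)

Section correspondences.
Context {R : realType} {X : normedModType R}.

Lemma convex_setP (A : set X) : convex_set A <->
  forall x y (t : R), A x -> A y -> 0 <= t -> t <= 1 ->
    A (t *: x + (1 - t) *: y).
Proof.
split=> [cA x y t Ax Ay t0 t1|cA x y t /set_mem Ax /set_mem Ay].
  by have := cA x y (Itv01 t0 t1) (mem_set Ax) (mem_set Ay) => /set_mem.
by apply/mem_set; exact: (cA x y t%:num).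
Qed.

(** The same weights applied to the nearby points of [A] give the required point. For a singleton
    [A] this is the convexity of open balls. *)
Lemma convex_set_neighborhood (A : set X) (e : R) : convex_set A ->
  convex_set [set z | exists2 k, A k & `|z - k| < e].
Proof.
move=> /convex_setP cA; apply/convex_setP => x y t [k Ak xk] [l Al yl] t0 t1.
exists (t *: k + (1 - t) *: l); first exact: cA.
rewrite opprD addrACA -!scalerBr (le_lt_trans (ler_normD _ _)) //.
have t1' : 0 <= 1 - t by rewrite subr_ge0.
rewrite !normrZ !ger0_norm//; move: xk yl.
set a := `|x - k|; set b := `|y - l| => ae be.
have -> : e = t * e + (1 - t) * e by rewrite -mulrDl addrC subrK mul1r.
have [->|t_neq0] := eqVneq t 0; first by rewrite !mul0r !add0r subr0 !mul1r.
by apply: ltr_leD; [rewrite ltr_pM2l// lt_def t_neq0|rewrite ler_wpM2l// ltW].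
Qed.

(** The total weight is kept as a factor instead of being divided out, since it may vanish; any
    point of [A] serves as [z] in that case. *)
Lemma convex_combination {I : eqType} (A : set X) (s : seq I) (w : I -> R)
    (y : I -> X) : convex_set A -> A !=set0 -> (forall i, 0 <= w i) ->
  (forall i, i \in s -> 0 < w i -> A (y i)) ->
  exists2 z, A z & \sum_(i <- s) w i *: y i = (\sum_(i <- s) w i) *: z.
Proof.
move=> /convex_setP cA [z0 Az0] w0; elim: s => [|i s IH] ys.
  by exists z0; rewrite // !big_nil scale0r.
have [|z Az zE] := IH; first by move=> j js; apply: ys; rewrite inE js orbT.
rewrite !big_cons zE; set W := \sum_(j <- s) w j.
have W0 : 0 <= W by exact: sumr_ge0.
have [wi0|wi0] := eqVneq (w i) 0.
  by exists z => //; rewrite wi0 scale0r !add0r.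
have wi : 0 < w i by rewrite lt_def wi0 w0.
have wW : 0 < w i + W by rewrite ltr_wpDr.
exists ((w i / (w i + W)) *: y i + (1 - w i / (w i + W)) *: z).
  apply: cA => //; first by apply: ys; rewrite ?mem_head.
    by rewrite divr_ge0// ltW.
  by rewrite ler_pdivrMr// mul1r lerDl.
rewrite scalerDr !scalerA mulrBr mulr1 mulrCA divff ?gt_eqF// mulr1.
by rewrite [w i + W]addrC addrK.
Qed.

Context {M : metricType R}.

Lemma lower_hemicontinuousP (psi : M -> set X) : lower_hemicontinuous psi <->
  forall x y e, psi x y -> 0 < e ->
    \forall v \near x, exists2 z, psi v z & `|y - z| < e.
Proof.
split=> [lhc x y e xy e0|lhc x U oU [y [xy Uy]]].
  have [|V [oV Vx VU]] := lhc x (ball y e) (ball_open _ _).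
    by exists y; split=> //; exact: ballxx.
  have : nbhs x V by exact: open_nbhs_nbhs.
  apply: filterS => v /VU[z [vz]]; rewrite -ball_normE /= => yz; by exists z.
have /nbhs_ballP[e /= e0 eU] : nbhs y U by exact: open_nbhs_nbhs.
have := lhc _ _ _ xy e0; rewrite /prop_near1 nbhsE => -[V [oV Vx] Vlhc].
exists V; split=> // v /Vlhc[z vz yz]; exists z; split=> //.
by apply: eU; rewrite -ball_normE.
Qed.

Lemma lower_hemicontinuous_setI_ball (psi : M -> set X) (c : M -> X)
    (rho : M -> R) : lower_hemicontinuous psi -> continuous c ->
  continuous rho ->
  lower_hemicontinuous (fun x => psi x `&` [set y | `|y - c x| < rho x]).
Proof.
move=> /lower_hemicontinuousP lhc cc crho; apply/lower_hemicontinuousP.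
move=> x y e [xy /= yc] e0.
(* The strict inequality at [x] leaves slack; a third of it pays for each of the moves from [y] to
   [z], [c x] to [c v] and [rho x] to [rho v]. *)
have g0 : 0 < (rho x - `|y - c x|) / 3 by rewrite divr_gt0// subr_gt0.
have me : 0 < Num.min e ((rho x - `|y - c x|) / 3) by rewrite lt_min e0 g0.
have /cvgrPdist_lt/(_ _ g0) := cc x; have /cvgrPdist_lt/(_ _ g0) := crho x.
have := lhc _ _ _ xy me; apply: filterS3 => v [z vz].
rewrite lt_min => /andP[yz yz'] rv cv; exists z => //; split=> //=.
have := ler_distD y z (c v); have := ler_distD (c x) y (c v).
by rewrite (distrC z y); have := ler_norm (rho x - rho v); lra.
Qed.

(** Values [y b] in [psi b] are averaged by a partition of unity subordinate to balls on which [psi]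
    keeps points within [e] of [y b]. Each [y b] contributing at [x] lies in the [e]-neighbourhood
    of [psi x], which is convex. *)
Lemma approximate_selection (psi : M -> set X) (e : R) :
  nonempty_valued psi -> convex_valued psi -> lower_hemicontinuous psi ->
  0 < e -> exists2 f : M -> X, continuous f &
    forall x, exists2 y, psi x y & `|f x - y| < e.
Proof.
move=> ne cvx /lower_hemicontinuousP lhc e0.
have /choice[y yP] : forall b, exists y, psi b y by exact: ne.
have /choice[r rP] : forall b, exists r, 0 < r <= 1 /\
    forall x, mdist b x < r -> exists2 z, psi x z & `|y b - z| < e.
  move=> b; have := lhc _ _ _ (yP b) e0.
  move=> /metricType_numDomainType.nbhs_mdistP[r /= r0 rb].
  exists (Num.min r 1); split; first by rewrite lt_min r0 ltr01 ge_min lexx orbT.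
  by move=> x; rewrite lt_min => /andP[/rb].
(* [u b] is positive exactly on the ball of radius [r b] around [b]; the cap [r b <= 1] keeps it
   within the unit interval. *)
pose u b x := Num.max 0 (r b - mdist b x).
have [||| w [w0 wlip wu wpos wfin]] := @locally_finite_refinement R M M u.
- move=> b x; have [/andP[r0 r1] _] := rP b; have := mdist_ge0 b x.
  by move=> ?; rewrite /u le_max lexx ge_max ler01/=; lra.
- move=> b x x'; have := metric_triangle b x x'; have := mdist_ge0 x x'.
  by rewrite /u !maxEle; do 2 case: ifPn; rewrite -?ltNge; lra.
- move=> x; exists x; have [/andP[r0 r1] _] := rP x.
  by rewrite /u lt_max mdistxx subr0 r0 orbT.
pose W x := \sum_(b \in [set: M]) w b x.
pose S x := \sum_(b \in [set: M]) w b x *: y b.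
(* Near [x0] both sums run over one fixed finite list, to which continuity and convexity of finite
   sums apply. *)
have loc (x0 : M) : exists s : seq M, \forall x \near x0,
    [/\ W x = \sum_(b <- s) w b x, S x = \sum_(b <- s) w b x *: y b &
      0 < \sum_(b <- s) w b x].
  have [F finF wF] := wfin x0; exists (fset_set F).
  apply: filterS wF => x wF.
  have nF b : ~ F b -> w b x = 0.
    by move=> nFb; apply/eqP; rewrite eq_le w0 andbT leNgt; apply/negP => /wF.
  have WE : W x = \sum_(b <- fset_set F) w b x.
    by rewrite -fsbig_finite//; apply/esym/fsbig_widen => // b [_ /nF].
  split=> //.
    rewrite -fsbig_finite//; apply/esym/fsbig_widen => // b [_ /nF /= ->].
    by rewrite scale0r.
  have [b wb] := wpos x; have bF : b \in fset_set F.
    by rewrite in_fset_set// mem_set//; exact: wF.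
  rewrite (bigD1_seq b) ?fset_uniq//=.
  by rewrite ltr_wpDr// sumr_ge0.
have wcont b : continuous (w b) by exact: lipschitz_continuous (wlip b).
exists (fun x => (W x)^-1 *: S x).
  move=> x0; have [s sP] := loc x0.
  have [WE SE Wpos] := nbhs_singleton sP.
  have sE : {near x0, (fun x => (\sum_(b <- s) w b x)^-1 *:
      \sum_(b <- s) w b x *: y b) =1 (fun x => (W x)^-1 *: S x)}.
    by apply: filterS sP => x [-> -> _].
  rewrite /continuous_at WE SE; apply: cvg_trans (near_eq_cvg sE) _.
  apply: cvgZ.
    apply: cvgV; first by rewrite gt_eqF.
    by apply: cvg_big => [|b _]; [exact: add_continuous|exact: wcont].
  apply: cvg_big => [|b _]; first exact: add_continuous.
  by apply: cvgZ; [exact: wcont|exact: cvg_cst].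
move=> x; have [s /nbhs_singleton[WE SE Wpos]] := loc x.
have [||||z [k xk zk] zE] := @convex_combination M
  [set z | exists2 k, psi x k & `|z - k| < e] s (w^~ x) y.
- exact: convex_set_neighborhood.
- have [k xk] := ne x; exists k, k => //; by rewrite subrr normr0.
- by move=> b; exact: w0.
- move=> b _ /wu; rewrite /u lt_max ltxx/= subr_gt0 => bx.
  by have [_ /(_ _ bx)[z xz yz]] := rP b; exists z.
exists k => //; rewrite WE SE zE scalerA mulVf ?gt_eqF// scale1r.
exact: zk.
Qed.
End correspondences.

(** * Dependent choice and sequences with geometrically decreasing steps *)

Lemma indexed_dependent_choice {T : Type} (P : nat -> T -> Prop)
    (Q : nat -> T -> T -> Prop) (t0 : T) : P 0 t0 ->
  (forall n t, P n t -> exists2 t', P n.+1 t' & Q n t t') ->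
  exists2 u : nat -> T, u 0 = t0 & forall n, P n (u n) /\ Q n (u n) (u n.+1).
Proof.
move=> P0 step.
have /choice[nx nxP] : forall nt : nat * T, exists t', P nt.1 nt.2 ->
    P nt.1.+1 t' /\ Q nt.1 nt.2 t'.
  move=> [n t] /=; have [/step[t' Pt' Qt']|nP] := pselect (P n t).
    by exists t'.
  by exists t.
pose u := fix u n := if n is m.+1 then nx (m, u m) else t0.
have uP n : P n (u n) by elim: n => // n IH; have [] := nxP (n, u n) IH.
by exists u => // n; split=> //; have [] := nxP (n, u n) (uP n).
Qed.

Section fast_sequences.
Context {R : realType} {X : completeNormedModType R}.

Lemma exists_divX2_lt (C e : R) : 0 < e -> exists n, C / 2 ^+ n < e.
Proof.
move=> e0; exists (Num.trunc (C / e)).+1.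
rewrite ltr_pdivrMr ?exprn_gt0// mulrC -ltr_pdivrMr//.
rewrite (lt_le_trans (truncnS_gt _)) // -natrX ler_nat ltnW//.
by rewrite ltn_expl.
Qed.

Lemma dist_geometric (u : nat -> X) (C : R) (n k : nat) :
  (forall j, (n <= j)%N -> `|u j.+1 - u j| <= C / 2 ^+ j) -> (n <= k)%N ->
  `|u k - u n| <= 2 * C / 2 ^+ n.
Proof.
move=> uC /subnKC <-.
have C0 : 0 <= C / 2 ^+ n by apply: le_trans (uC _ (leqnn n)).
have pos j : 0 <= 2 * C / 2 ^+ (n + j).
  rewrite exprD invfM mulrA mulr_ge0 ?invr_ge0 ?exprn_ge0//.
  by rewrite -mulrA mulr_ge0.
(* Subtracting the remaining tail of the geometric series strengthens the bound enough for
   induction. *)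
suff H j : `|u (n + j)%N - u n| <= 2 * C / 2 ^+ n - 2 * C / 2 ^+ (n + j).
  by rewrite (le_trans (H _)) // lerBlDr lerDl pos.
elim: j => [|j IH]; first by rewrite addn0 !subrr normr0.
rewrite addnS; have := uC (n + j)%N (leq_addr _ _).
have := ler_distD (u (n + j)%N) (u (n + j).+1) (u n).
have -> : 2 * C / 2 ^+ (n + j).+1 = C / 2 ^+ (n + j).
  by rewrite exprS invfM mulrACA divff ?mul1r// pnatr_eq0.
move: IH; rewrite -(mulrA 2 C (2 ^+ (n + j))^-1); lra.
Qed.

Lemma cvg_dist_geometric (u : nat -> X) (C : R) (n : nat) (l : X) :
  (forall j, (n <= j)%N -> `|u j.+1 - u j| <= C / 2 ^+ j) ->
  u k @[k --> \oo] --> l -> `|l - u n| <= 2 * C / 2 ^+ n.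
Proof.
move=> uC /cvgrPdist_lt ul; apply/ler_addgt0Pr => e e0.
have [N _ uN] := ul e e0.
have := uN (maxn N n) (leq_maxl _ _); have := dist_geometric uC (leq_maxr N n).
have := ler_distD (u (maxn N n)) l (u n); move=> /= *; lra.
Qed.

Lemma cvg_geometric_steps (u : nat -> X) (C : R) :
  (forall j, `|u j.+1 - u j| <= C / 2 ^+ j) -> cvgn u.
Proof.
move=> uC; apply/cauchy_cvgP/cauchyP => e e0.
have [n ne] := exists_divX2_lt (2 * C) e0.
exists (u n); exists n => // k /= nk; rewrite -ball_normE /= distrC.
exact: le_lt_trans (dist_geometric (fun j _ => uC j) nk) ne.
Qed.

(** Since [C] is the same at all points, the convergence is uniform, and continuity passes to the
    limit with thirds of [e]. *)
Lemma continuous_limit_geometric_steps {M : topologicalType}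
    (u : nat -> M -> X) (C : R) : (forall n, continuous (u n)) ->
  (forall n x, `|u n.+1 x - u n x| <= C / 2 ^+ n) ->
  exists2 f : M -> X, continuous f & forall x, u n x @[n --> \oo] --> f x.
Proof.
move=> cu uC; pose f x := lim (u n x @[n --> \oo]).
have uf x : u n x @[n --> \oo] --> f x.
  exact: (@cvg_geometric_steps (u ^~ x) C (uC ^~ x)).
have fu n x : `|f x - u n x| <= 2 * C / 2 ^+ n.
  by apply: (@cvg_dist_geometric (u ^~ x) C n) => // j _; exact: uC.
exists f => // x; apply/cvgrPdist_lt => e e0.
have e3 : 0 < e / 3 by rewrite divr_gt0.
have [n ne] := exists_divX2_lt (2 * C) e3.
have /cvgrPdist_lt/(_ _ e3) := cu n x; apply: filterS => y.
have := fu n x; have := fu n y; rewrite (distrC (f y)).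
have := ler_distD (u n x) (f x) (f y); have := ler_distD (u n y) (u n x) (f y).
lra.
Qed.

End fast_sequences.

(** * Michael's theorem and selections through a given point *)

Section selections.
Context {R : realType} {M : metricType R} {X : completeNormedModType R}.

Lemma convex_setI_ball (A : set X) (c : X) (r : R) : convex_set A ->
  convex_set (A `&` [set y | `|y - c| < r]).
Proof.
have c1 : convex_set [set c].
  apply/convex_setP => x y t -> -> _ _ /=.
  by rewrite -scalerDl addrC subrK scale1r.
move=> /convex_setP cA; have /convex_setP cB := @convex_set_neighborhood _ _ _ r c1.
apply/convex_setP => x y t [Ax xc] [Ay yc] t0 t1; split; first exact: cA.
by have [||_ -> //] := cB x y t _ _ t0 t1; exists c.
Qed.

(* Michael's selection theorem, for values that need not be closed. *)
Lemma closure_selection (psi : M -> set X) :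
  nonempty_valued psi -> convex_valued psi -> lower_hemicontinuous psi ->
  exists2 f : M -> X, continuous f & forall x, closure (psi x) (f x).
Proof.
move=> ne cvx lhc.
pose close (e : R) (f : M -> X) := forall x, exists2 y, psi x y & `|f x - y| < e.
pose P n (f : M -> X) := continuous f /\ close ((2 ^+ n)^-1) f.
pose Q n (f g : M -> X) := forall x, `|g x - f x| <= 2 / 2 ^+ n.
have pow0 n : 0 < (2 ^+ n)^-1 :> R by rewrite invr_gt0 exprn_gt0.
have [f0 cf0 f0P] := approximate_selection ne cvx lhc (pow0 0).
have [||u _ uP] := @indexed_dependent_choice _ P Q f0.
- by split.
- move=> n f [cf fP].
  have crho : continuous (fun _ : M => (2 ^+ n)^-1 : R) by move=> ?; exact: cvg_cst.
  (* Approximating inside the ball of radius [2^-n] around [f x] makes the step at most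
     [2^-n + 2^-(n+1)]. *)
  have [||g cg gP] := approximate_selection (psi :=
      fun x => psi x `&` [set y | `|y - f x| < (2 ^+ n)^-1]) _ _
      (lower_hemicontinuous_setI_ball lhc cf crho) (pow0 n.+1).
  + by move=> x; have [y xy fy] := fP x; exists y; split=> //=; rewrite distrC.
  + by move=> x; exact: convex_setI_ball.
  exists g; first by split=> // x; have [y [xy _] gy] := gP x; exists y.
  move=> x; have [y [xy /= fy] gy] := gP x.
  have := ler_distD y (g x) (f x); have := pow0 n.
  by move: gy; rewrite exprS invfM; lra.
have [f cf uf] := continuous_limit_geometric_steps
  (fun n => (uP n).1.1) (fun n => (uP n).2).
exists f => // x U /nbhs_ballP[e /= e0 eU].
have e3 : 0 < e / 3 by rewrite divr_gt0.
have [n n_lt] := exists_divX2_lt (2 * 2) e3.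
have [y xy uy] := (uP n).1.2 x; exists y; split=> //; apply: eU.
have := cvg_dist_geometric (fun j _ => (uP j).2 x) (uf x) (n := n).
rewrite -ball_normE /=; have := ler_distD (u n x) (f x) y.
move: n_lt; have := pow0 n; lra.
Qed.

(** For [x] other than [b], the strict inequality [gamma < beta] puts the points supplied by the
    Lipschitz condition into the open ball. The selection obtained lies in the closure of [psi x],
    hence in the closed set [phi x] and in the closed ball. *)
Lemma pointwise_lipschitz_selection (phi : M -> set X) (gamma beta : R)
    (b : M) (c : X) : closed_valued phi -> convex_valued phi ->
  lower_hemicontinuous phi -> lower_pointwise_lipschitz_at gamma phi b ->
  phi b c -> 0 <= gamma -> gamma < beta ->
  exists g : M -> X, [/\ is_selection phi g, continuous g &
    forall x, `|g x - c| <= beta * mdist b x].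
Proof.
move=> clo cvx lhc lip bc g0 gb.
have near_c x : exists2 z, phi x z & `|z - c| <= gamma * mdist b x.
  have [z [xz [v /= v1 vz]]] := lip _ bc x; exists z => //.
  rewrite -vz addrC addKr normrZ ger0_norm ?mulr_ge0 ?mdist_ge0//.
  by rewrite ler_piMr// mulr_ge0 ?mdist_ge0.
pose B x := [set y | `|y - c| < beta * mdist b x].
pose psi x := [set y | phi x y /\ (B x y \/ x = b /\ y = c)].
have cB : lower_hemicontinuous (fun x => phi x `&` B x).
  apply: lower_hemicontinuous_setI_ball => //; first by move=> ?; exact: cvg_cst.
  apply: (@lipschitz_continuous _ _ beta) => x y.
  rewrite -mulrBr ler_wpM2l ?(ltW (le_lt_trans g0 gb))//.
  by rewrite lerBlDl (metric_sym x y) metric_triangle.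
have near_psi x : exists2 z, psi x z & `|z - c| <= gamma * mdist b x.
  have [->|xb] := eqVneq x b.
    exists c; last by rewrite subrr normr0 mulr_ge0 ?mdist_ge0.
    by split=> //; right.
  have [z xz zc] := near_c x; exists z => //; split=> //; left.
  by rewrite /B /= (le_lt_trans zc)// ltr_pM2r// mdist_gt0 eq_sym.
have [||| g cg gP] := @closure_selection psi.
- by move=> x; have [z xz _] := near_psi x; exists z.
- move=> x; apply/convex_setP => y z t [xy yB] [xz zB] t0 t1.
  split; first by have /convex_setP := cvx x; apply.
  have [xb|xb] := eqVneq x b.
    right; split=> //.
    have {}Bb w : ~ B x w by rewrite /B /= xb mdistxx mulr0 normr_lt0.
    move: yB zB => [/Bb//|[_ ->]] [/Bb//|[_ ->]].
    by rewrite -scalerDl addrC subrK scale1r.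
  left; have : convex_set (setT `&` B x) by apply: convex_setI_ball.
  move=> /convex_setP/(_ y z t) [] //.
  - by split=> //; move: yB => [//|[/eqP]]; rewrite (negbTE xb).
  - by split=> //; move: zB => [//|[/eqP]]; rewrite (negbTE xb).
(* For [y] in the open ball, the intersection with [B] is already lower hemicontinuous. At [(b, c)],
   each [psi v] has a point within [gamma d(b, v)] of [c]. *)
- apply/lower_hemicontinuousP => x y e [xy [yB|[xb yc]]] e0.
    move/lower_hemicontinuousP: cB => /(_ x y e (conj xy yB) e0).
    by apply: filterS => v [z [vz zB] yz]; exists z => //; split=> //; left.
  apply/metricType_numDomainType.nbhs_mdistP.
  exists (e / (gamma + 1)) => /=; first by rewrite divr_gt0// ltr_wpDl.
  move=> v /=; rewrite ltr_pdivlMr ?ltr_wpDl// xb yc => bv.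
  have [z vz zc] := near_psi v; exists z => //; rewrite distrC.
  rewrite (le_lt_trans zc)// (le_lt_trans _ bv)// mulrC ler_wpM2l ?mdist_ge0//.
  by rewrite lerDl.
exists g; split=> //.
  by move=> x; apply: clo; apply: closure_subset (gP x) => y [].
move=> x; rewrite distrC; apply: closed_closed_ball_.
apply: closure_subset (gP x) => y [_ [/ltW yc|[-> ->]]]; rewrite /closed_ball_ /=.
  by rewrite distrC.
by rewrite subrr normr0 mdistxx mulr0.
Qed.

End selections.

(** * Separated sets and nets *)

Section separated_sets.
Context {R : realType} {M : metricType R}.

Definition separated (delta : R) (D : set M) :=
  forall b b', D b -> D b' -> b <> b' -> delta <= mdist b b'.

(** A point of the closure outside [D] would have a point of [D] within [delta / 2] and another one
    strictly closer, two distinct points less than [delta] apart. *)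
Lemma separated_closed (delta : R) (D : set M) :
  0 < delta -> separated delta D -> closed D.
Proof.
move=> d0 sep x; have d2 : 0 < delta / 2 by rewrite divr_gt0.
move=> clx; have [b [Db]] := clx _ (nbhsx_ballx x _ d2).
rewrite ballEmdist /= => xb; have [->//|/eqP/eqP xb0] := eqVneq x b.
have e0 : 0 < Num.min (mdist x b) (delta / 2) by rewrite lt_min mdist_gt0 xb0 d2.
have [c [Dc]] := clx _ (nbhsx_ballx x _ e0).
rewrite ballEmdist /= lt_min => /andP[xc xc2].
have bc : b <> c by move=> bc; rewrite bc ltxx in xc.
have := sep _ _ Db Dc bc; have := metric_triangle b x c.
rewrite (metric_sym b x); lra.
Qed.

(** The centres of a maximal disjoint family of balls of radius [delta] form such a set: by
    maximality the ball around any [x] meets one of them. *)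
Lemma exists_separated_net (delta : R) : 0 < delta ->
  exists2 D : set M, separated delta D &
    forall x, exists2 b, D b & mdist x b < 2 * delta.
Proof.
move=> d0; have [D [_ triv maxD]] :=
  ex_maximal_disjoint_subcollection (fun x : M => ball x delta) setT.
exists D.
  move=> b b' Db Db' bb'; rewrite leNgt; apply/negP => lt_bb'.
  apply: bb'; apply: triv => //; exists b'; split; last exact: ballxx.
  by rewrite ballEmdist.
move=> x; apply: contrapT => far.
have xD b : D b -> ~ (ball x delta `&` ball b delta !=set0).
  move=> Db [z []]; rewrite !ballEmdist /= => xz bz; apply: far; exists b => //.
  have := metric_triangle x z b; rewrite (metric_sym z b); lra.
apply: (maxD (D `|` [set x])) => //.
  split; first by move=> y Dy; left.
  move=> sub; have Dx : D x by apply: sub; right.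
  by apply: (xD x Dx); exists x; split; exact: ballxx.
move=> i j [Di|->] [Dj|->] ij //.
- exact: triv.
- by have := xD i Di; rewrite setIC => /(_ ij).
- by have := xD j Dj ij.
Qed.

End separated_sets.

(** * Correction on a separated set, iteration and conclusion *)

Section main.
Context {R : realType} {M : metricType R} {X : completeNormedModType R}.

(** The quotient is at most [beta] on some interval [(0, r)], and the upper limit is at most the
    supremum over that interval. *)
Lemma pointwise_lipschitz_at_near (beta : R) (f : M -> X) (b : M) :
  0 <= beta -> (\forall x \near b, `|f b - f x| <= beta * mdist b x) ->
  pointwise_lipschitz_at beta f b.
Proof.
move=> b0 /metricType_numDomainType.nbhs_mdistP[r /= r0 rf].
have Vr : \forall s \near (0 : R)^'+, 0 < s < r by near=> s; apply/andP; split.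
rewrite /pointwise_lipschitz_at limf_esupE; apply: ge_ereal_inf.
eexists; first by exists [set s : R | 0 < s < r]; [exact: Vr|reflexivity].
apply: ge_ereal_sup => _ [s /andP[s0 sr] <-].
rewrite muleC lee_pdivrMr//; apply: ge_ereal_sup => _ [a /= as_ <-].
rewrite -EFinM lee_fin; move: as_; rewrite metric_sym => ab.
apply: le_trans (rf a (le_lt_trans ab sr)) _.
by rewrite ler_wpM2l.
Unshelve. all: by end_near. Qed.

(* Replace [f] near each [b] in [D] by a selection [g b] through [(b, f b)]
   growing at most linearly away from [b]; the cut-off functions [t b] have
   disjoint supports, since [D] is separated. *)
Lemma selection_correction (phi : M -> set X) (gamma beta eps delta : R)
    (A D : set M) (f : M -> X) :
  closed_valued phi -> convex_valued phi -> lower_hemicontinuous phi ->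
  lower_pointwise_lipschitz gamma phi -> 0 <= gamma -> gamma < beta ->
  0 < eps -> 0 < delta -> closed A -> separated delta D ->
  (forall b, D b -> ~ A b) -> is_selection phi f -> continuous f ->
  exists f' : M -> X, [/\ is_selection phi f', continuous f',
    forall x, `|f' x - f x| <= eps,
    forall a x, A a -> `|f' x - f x| <= eps * mdist a x &
    forall b, D b -> \forall x \near b, `|f' b - f' x| <= beta * mdist b x].
Proof.
move=> clo cvx lhc lip g0 gb e0 d0 cA sep DA sf cf.
(* The bound [delta / 4] keeps the supports away from points at distance [delta / 2] from [D]. Off
   [D], the default [g = f] makes the interpolation trivial. *)
pose good b (g : M -> X) r := [/\ is_selection phi g, continuous g,
  0 < r <= delta / 4,
  forall x, mdist b x < r -> `|g x - f x| <= eps /\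
    forall a, A a -> `|g x - f x| <= eps * mdist a x &
  if pselect (D b) then forall x, `|g x - f b| <= beta * mdist b x else g = f].
have /choice[g /choice[r good_gr]] : forall b, exists g r, good b g r.
  move=> b; rewrite /good; case: pselect => [Db|nDb]; last first.
    exists f, (delta / 4); split=> //; first by rewrite divr_gt0 /=.
    move=> x _; rewrite subrr normr0; split; first exact: ltW.
    by move=> a _; rewrite mulr_ge0 ?mdist_ge0// ltW.
  have [g [sg cg gP]] :=
    pointwise_lipschitz_selection clo cvx lhc (lip b) (sf b) g0 gb.
  have [rho rho0 Arho] : exists2 rho, 0 < rho &
      forall x, mdist b x < rho -> ~ A x.
    have : nbhs b (~` A).
      by apply: open_nbhs_nbhs; split; [exact: closed_openC|exact: DA].
    by move=> /metricType_numDomainType.nbhs_mdistP[rho]; exists rho.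
  have gfb : g b = f b.
    by apply/eqP; rewrite -subr_eq0 -normr_le0 (le_trans (gP b))// mdistxx mulr0.
  (* A point [x] within [rho / 2] of [b] has distance at least [rho / 2] from [A], so
     [eps * (rho / 2)] is below [eps * mdist a x] for [a] in [A]. *)
  have m0 : 0 < Num.min eps (eps * (rho / 2)).
    by rewrite lt_min e0 mulr_gt0// divr_gt0.
  have : \forall x \near b, `|g x - f x| < Num.min eps (eps * (rho / 2)).
    have m2 : 0 < Num.min eps (eps * (rho / 2)) / 2 by rewrite divr_gt0.
    have /cvgrPdist_lt/(_ _ m2) := cf b; have /cvgrPdist_lt/(_ _ m2) := cg b.
    apply: filterS2 => x; have := ler_distD (f b) (g x) (f x).
    by rewrite gfb (distrC (g x) (f b)); lra.
  move=> /metricType_numDomainType.nbhs_mdistP[r1 /= r10 r1P].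
  exists g, (Num.min r1 (Num.min (rho / 2) (delta / 4))); split=> //.
    by rewrite !lt_min r10 !divr_gt0//= !ge_min lexx !orbT.
  move=> x; rewrite !lt_min => /and3P[/r1P + br _].
  rewrite lt_min => /andP[lt1 lt2]; split=> [|a Aa]; first exact: ltW.
  rewrite (le_trans (ltW lt2))// ler_pM2l//.
  have : rho <= mdist b a by rewrite leNgt; apply/negP => /Arho.
  by have := metric_triangle b x a; rewrite (metric_sym x a); lra.
(* The cut-off is 1 within [r b / 2] of [b], 0 beyond [r b], and has slope [2 / r b] between. *)
pose t b x := Num.max 0 (Num.min 1 (2 - 2 / r b * mdist b x)).
have r0 b : 0 < r b by have [_ _ /andP[]] := good_gr b.
have rd b : r b <= delta / 4 by have [_ _ /andP[]] := good_gr b.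
have gD b x : D b -> `|g b x - f b| <= beta * mdist b x.
  by have [_ _ _ _] := good_gr b; case: pselect => // _ + _; exact.
have gND b : ~ D b -> g b = f.
  by have [_ _ _ _] := good_gr b; case: pselect.
have t01 b x : 0 <= t b x <= 1 by rewrite le_max lexx ge_max ler01 ge_min lexx.
have ct b : continuous (t b).
  apply: (@lipschitz_continuous _ _ (2 / r b)) => x y.
  have : 2 / r b * mdist b y <= 2 / r b * (mdist b x + mdist x y).
    by rewrite ler_pM2l ?divr_gt0// metric_triangle.
  have : 0 <= 2 / r b * mdist x y by rewrite mulr_ge0 ?mdist_ge0// divr_ge0 ?ltW.
  rewrite mulrDr /t !maxEle !minEle.
  by do 4 case: ifPn; rewrite -?ltNge; lra.
have t0 b x : r b <= mdist b x -> t b x = 0.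
  move=> rbx; have : 2 / r b * r b <= 2 / r b * mdist b x.
    by rewrite ler_pM2l ?divr_gt0.
  rewrite divfK ?gt_eqF// => le2; rewrite /t max_l// ge_min; apply/orP; right.
  by rewrite subr_le0.
have t1 b x : mdist b x < r b / 2 -> t b x = 1.
  move=> bx; have : 2 / r b * mdist b x <= 2 / r b * (r b / 2).
    by rewrite ler_pM2l ?divr_gt0 ?ltW.
  rewrite mulrA divfK ?gt_eqF// divff ?pnatr_eq0// => le1.
  by rewrite /t min_l ?max_r//; lra.
(* At most one point of [D] lies within [delta / 2] of [x]. If there is none, [k x] is [x] itself,
   which is then outside [D], so [f x] is unchanged. *)
pose k x := xget x [set b | D b /\ mdist b x < delta / 2].
have kE b x : D b -> mdist b x < delta / 2 -> k x = b.
  move=> Db bx; apply: contrapT => kb; rewrite /k in kb.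
  have [Dk kx] := xgetPex x
    (ex_intro (fun b => D b /\ mdist b x < delta / 2) b (conj Db bx)).
  have := sep _ _ Dk Db kb; have := metric_triangle (k x) x b.
  by rewrite (metric_sym x b); move: kx; rewrite -/(k x); lra.
pose F b x := f x + t b x *: (g b x - f x).
have cF b : continuous (F b).
  have [_ cg _ _ _] := good_gr b; move=> x.
  apply: cvgD; first exact: cf.
  by apply: cvgZ; [exact: ct|apply: cvgB; [exact: cg|exact: cf]].
exists (fun x => F (k x) x).
have Ff x c : 0 <= c -> (mdist (k x) x < r (k x) ->
    `|g (k x) x - f x| <= c) -> `|F (k x) x - f x| <= c.
  move=> c0 close; rewrite /F addrC addKr normrZ.
  have [kx|/t0->] := ltP (mdist (k x) x) (r (k x)); last by rewrite normr0 mul0r.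
  have /andP[? ?] := t01 (k x) x; rewrite ger0_norm// (le_trans _ (close kx))//.
  by rewrite ler_piMl.
split.
- move=> x; have [sg _ _ _ _] := good_gr (k x); have /andP[? ?] := t01 (k x) x.
  rewrite /F.
  have -> : f x + t (k x) x *: (g (k x) x - f x) =
      t (k x) x *: g (k x) x + (1 - t (k x) x) *: f x.
    by rewrite scalerBr scalerBl scale1r addrCA.
  by have /convex_setP := cvx x; apply.
- move=> x0.
  (* Within [delta / 2] of some [b] in [D], [k] is locally constant. Otherwise points within
     [delta / 4] of [x0] are outside every support, and the new map is locally [f]. *)
  have [[b [Db bx0]]|far] := pselect (exists b, D b /\ mdist b x0 < delta / 2).
    have near_b : {near x0, F b =1 (fun x => F (k x) x)}.
      apply/metricType_numDomainType.nbhs_mdistP.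
      exists (delta / 2 - mdist b x0) => /=; first by rewrite subr_gt0.
      move=> x /= x0x; rewrite (kE b)//.
      by have := metric_triangle b x0 x; lra.
    rewrite /continuous_at -(nbhs_singleton near_b).
    by apply: cvg_trans (near_eq_cvg near_b) _; exact: cF.
  have near_f : {near x0, f =1 (fun x => F (k x) x)}.
    apply/metricType_numDomainType.nbhs_mdistP.
    exists (delta / 4) => /=; first by rewrite divr_gt0.
    move=> x /= x0x; rewrite /F.
    have [Dk|/gND->] := pselect (D (k x)); last by rewrite subrr scaler0 addr0.
    rewrite t0 ?scale0r ?addr0// (le_trans (rd _)) //.
    have : delta / 2 <= mdist (k x) x0.
      by rewrite leNgt; apply/negP => kx0; apply: far; exists (k x).
    by have := metric_triangle (k x) x x0; rewrite (metric_sym x x0); lra.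
  rewrite /continuous_at -(nbhs_singleton near_f).
  by apply: cvg_trans (near_eq_cvg near_f) _; exact: cf.
- move=> x; have [_ _ _ gf _] := good_gr (k x); apply: Ff; first exact: ltW.
  by move=> /gf[].
- move=> a x Aa; have [_ _ _ gf _] := good_gr (k x); apply: Ff.
    by rewrite mulr_ge0 ?mdist_ge0// ltW.
  by move=> /gf[_]; exact.
- move=> b Db; apply/metricType_numDomainType.nbhs_mdistP.
  exists (r b / 2) => /=; first by rewrite divr_gt0.
  have E x : mdist b x < r b / 2 -> F (k x) x = g b x.
    move=> bx; rewrite (kE b)//; last by have := rd b; have := r0 b; lra.
    by rewrite /F t1// scale1r addrC subrK.
  move=> x /= bx; rewrite !E ?mdistxx ?divr_gt0//.
  have -> : g b b = f b.
    by apply/eqP; rewrite -subr_eq0 -normr_le0 (le_trans (gD b b Db))// mdistxx mulr0.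
  by rewrite distrC gD.
Qed.

Lemma dense_pointwise_lipschitz_selection (phi : M -> set X)
    (gamma beta eps : R) (f0 : M -> X) :
  closed_valued phi -> convex_valued phi -> lower_hemicontinuous phi ->
  lower_pointwise_lipschitz gamma phi -> 0 <= gamma -> gamma < beta ->
  0 < eps -> is_selection phi f0 -> continuous f0 ->
  exists f : M -> X, [/\ is_selection phi f, continuous f,
    forall x, `|f x - f0 x| <= 2 * eps &
    exists2 S : set M, dense S & pointwise_lipschitz_on (beta + 2 * eps) f S].
Proof.
move=> clo cvx lhc lip g0 gb e0 sf0 cf0.
have pow0 n : 0 < (2 ^+ n)^-1 :> R by rewrite invr_gt0 exprn_gt0.
have /choice[D DP] : forall n, exists D : set M, separated (2 ^+ n)^-1 D /\
    forall x, exists2 b, D b & mdist x b < 2 * (2 ^+ n)^-1.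
  by move=> n; have [D ? ?] := @exists_separated_net _ M _ (pow0 n); exists D.
(* [A n] collects the stages before [n]; it is empty for [n = 0], and stage [n] treats only the
   points of [D n] outside it. *)
pose A n := \bigcup_(i in `I_n) D i.
have cA n : closed (A n).
  apply: closed_bigcup => [|i _]; first exact: finite_II.
  exact: separated_closed (pow0 i) (DP i).1.
pose P (n : nat) (f : M -> X) := is_selection phi f /\ continuous f.
pose Q n (f f' : M -> X) := [/\ forall x, `|f' x - f x| <= eps / 2 ^+ n,
  forall a x, A n a -> `|f' x - f x| <= eps / 2 ^+ n * mdist a x &
  forall b, D n b -> ~ A n b ->
    \forall x \near b, `|f' b - f' x| <= beta * mdist b x].
have [||u u0 uP] := @indexed_dependent_choice _ P Q f0.
- by split.
- move=> n f [sf cf].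
  have sepD : separated (2 ^+ n)^-1 (D n `\` A n).
    by move=> b b' [Db _] [Db' _]; exact: (DP n).1.
  have [f' [sf' cf' f'1 f'2 f'3]] := selection_correction clo cvx lhc lip g0 gb
    (mulr_gt0 e0 (pow0 n)) (pow0 n) (cA n) sepD (fun b Db => Db.2) sf cf.
  by exists f'; split=> // b Db nAb; exact: f'3.
have us n : is_selection phi (u n) by case: (uP n).1.
have Q1 n x : `|u n.+1 x - u n x| <= eps / 2 ^+ n by have [_ []] := uP n.
have Q2 n a x : A n a -> `|u n.+1 x - u n x| <= eps / 2 ^+ n * mdist a x.
  by have [_ [_ + _]] := uP n; exact.
have [f cf uf] := continuous_limit_geometric_steps (fun n => (uP n).1.2) Q1.
exists f; split=> //.
- move=> x; have phi_u : \forall n \near \oo, phi x (u n x).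
    by apply: nearW => n; exact: us.
  exact: (closed_cvg _ (clo x) phi_u _ (uf x)).
- move=> x; have := cvg_dist_geometric (fun j _ => Q1 j x) (uf x) (n := 0).
  by rewrite u0 expr0 divr1.
exists (\bigcup_n D n).
  move=> U [x Ux] oU; have /nbhs_ballP[e /= e_gt0 eU] : nbhs x U.
    exact: open_nbhs_nbhs.
  have [n ne] := exists_divX2_lt 2 e_gt0; have [b Db xb] := (DP n).2 x.
  exists b; split; last by exists n.
  by apply: eU; rewrite ballEmdist /= (lt_trans xb).
move=> b Sb; apply: pointwise_lipschitz_at_near; first by lra.
(* The least [n] with [b] in [D n] is the stage at which [b] is treated. *)
have [n Db nAb] : exists2 n, D n b & ~ A n b.
  have exD : exists n, `[< D n b >] by case: Sb => n _ ?; exists n; exact/asboolP.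
  exists (ex_minn exD); case: ex_minnP => n /asboolP // _ min_n [i /= lt_in Di].
  by have := min_n i; rewrite leqNgt lt_in => /(_ (asboolT Di)).
have [_ [_ _ /(_ b Db nAb)]] := uP n; apply: filterS => x ubx.
(* From stage [n.+1] on, [b] belongs to [A j], so the steps at [y] are geometric with constant
   [eps * mdist b y]. In particular the value at [b] no longer changes. *)
have fu y : `|f y - u n.+1 y| <= 2 * (eps * mdist b y) / 2 ^+ n.+1.
  apply: (@cvg_dist_geometric _ _ (u ^~ y)) => // j nj.
  by rewrite mulrAC Q2//; exists n.
have fb : f b = u n.+1 b.
  apply/eqP; rewrite -subr_eq0 -normr_le0 (le_trans (fu b))//.
  by rewrite mdistxx !mulr0 mul0r.
have : 2 * (eps * mdist b x) / 2 ^+ n.+1 <= 2 * (eps * mdist b x).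
  have : 0 <= eps * mdist b x by rewrite mulr_ge0 ?mdist_ge0// ltW.
  move=> ed0; apply: ler_piMr; first by rewrite mulr_ge0.
  by rewrite invf_le1 ?exprn_gt0// exprn_ege1// ler1n.
have := fu x; have := ler_distD (u n.+1 x) (f b) (f x).
rewrite (distrC (u n.+1 x) (f x)) fb (mulrDl beta) -(mulrA 2 eps); lra.
Qed.

End main.

Theorem corollary4p5 (R : realType) (M : metricType R)
    (X : completeNormedModType R) (alpha : R) (phi : M -> set X)
    (alpha_ge0 : 0 <= alpha)
    (phi_nonempty : nonempty_valued phi)
    (phi_closed : closed_valued phi)
    (phi_convex : convex_valued phi)
    (phi_lhc : lower_hemicontinuous phi)
    (phi_lip : forall eps : R, 0 < eps ->
       lower_pointwise_lipschitz (alpha + eps) phi) :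
  (forall beta : R, alpha < beta ->
     exists f : M -> X, [/\ is_selection phi f, continuous f &
       exists S : set M, dense S /\ pointwise_lipschitz_on beta f S])
  /\
  ((exists g : M -> X,
      [/\ is_selection phi g, continuous g & bounded_fun g]) ->
   forall beta : R, alpha < beta ->
     exists f : M -> X,
       [/\ is_selection phi f, continuous f, bounded_fun f &
         exists S : set M, dense S /\ pointwise_lipschitz_on beta f S]).
Proof.
have near_selection beta f0 : alpha < beta -> is_selection phi f0 ->
    continuous f0 -> exists f : M -> X, [/\ is_selection phi f, continuous f,
      forall x, `|f x - f0 x| <= (beta - alpha) / 2 &
      exists S : set M, dense S /\ pointwise_lipschitz_on beta f S].
  (* With [eps = (beta - alpha) / 4], the slope [alpha + eps] is below the midpoint of [alpha] and
     [beta], and the midpoint plus [2 * eps] is [beta]. *)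
  move=> ab sf0 cf0; have e0 : 0 < (beta - alpha) / 4.
    by rewrite divr_gt0// subr_gt0.
  have [||f [sf cf ff0 [S dS lS]]] := dense_pointwise_lipschitz_selection
    (beta := (alpha + beta) / 2) phi_closed phi_convex phi_lhc
    (phi_lip _ e0) _ _ e0 sf0 cf0; [lra|lra|].
  exists f; split=> //; first by move=> x; apply: le_trans (ff0 x) _; lra.
  exists S; split=> //.
  by have -> : beta = (alpha + beta) / 2 + 2 * ((beta - alpha) / 4) by lra.
split=> [beta ab|[g [sg cg bg]] beta ab].
  have [f0 cf0 f0P] := closure_selection phi_nonempty phi_convex phi_lhc.
  have sf0 : is_selection phi f0 by move=> x; exact: phi_closed.
  by have [f [sf cf _ Sf]] := near_selection beta f0 ab sf0 cf0; exists f.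
(* Starting from the bounded [g], the result stays within [(beta - alpha) / 2] of it and is
   therefore bounded. *)
have [f [sf cf fg Sf]] := near_selection beta g ab sg cg; exists f; split=> //.
have /pinfty_ex_gt0[C C0 gC] := bg.
exists (C + (beta - alpha) / 2); split; first exact: num_real.
move=> K CK x _ /=; have := gC x Logic.I; have := fg x => /= fgx gx.
rewrite (le_trans _ (ltW CK))// -(subrK (g x) (f x)) addrC.
by rewrite (le_trans (ler_normD _ _))// lerD.
Qed.
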